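(* Let $G$ be the Mathieu group $M_{11}$ and let $w$ be the word in the free group on $x,y$ given by \[ w=[\,x^{-440}(x^{-440})^{(y^{-440})}x^{-440},\ (y^{-440})^{(x^{-440}y^{-440})}y^{-440}\,].\] Then $w(G)$ contains an element $g$ such that $o(g)=11$ and $g^{-1}\notin w(G)$; that is, the word $w$ witnesses the chirality of $G$.
   Context: $M_{11}$ is the Mathieu group of order $7920$. For group elements $a,b$: $[a,b]=a^{-1}b^{-1}ab$, and an exponent that is a group element denotes conjugation, $a^{b}=b^{-1}ab$ (an integer exponent denotes the usual power). $o(g)$ denotes the order of the element $g$. For a word $w$ in the free group on $x,y$, $w(G)=\{w(a,b): a,b\in G\}$ is the image of the word map $G^2\to G$, $(a,b)\mapsto w(a,b)$, obtained by substituting $a$ for $x$ and $b$ for $y$. A word $w$ witnesses the chirality of $G$ if there is $g\in w(G)$ with $g^{-1}\notin w(G)$. *)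

(* Defs.v *)
From HB Require Import structures.
From mathcomp Require Import all_boot all_algebra all_fingroup.

Set Implicit Arguments.
Unset Strict Implicit.
Unset Printing Implicit Defensive.

Local Open Scope group_scope.

Section FreeGroup.

Variable I : choiceType.

(* The letter (i, false) stands for the generator i, (i, true) for its
   inverse. *)
Definition letter := (I * bool)%type.

Definition inv_letter (l : letter) : letter := (l.1, ~~ l.2).

Definition reduced (s : seq letter) :=
  sorted (fun l l' => l' != inv_letter l) s.

Definition free_cons (l : letter) (s : seq letter) :=
  if s is l' :: s' then if l' == inv_letter l then s' else l :: s else [:: l].

Definition free_cat (s t : seq letter) := foldr free_cons t s.

Definition free_inv (s : seq letter) := rev (map inv_letter s).

Lemma inv_letterK : involutive inv_letter.
Proof. by case=> i b; rewrite /inv_letter /= negbK. Qed.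

Lemma reduced_cons l s : reduced s -> reduced (free_cons l s).
Proof.
case: s => //= l' s red_s; case: eqP => [_ | /eqP neq] /=.
  exact: path_sorted red_s.
by rewrite neq.
Qed.

Lemma free_consK l s :
  reduced s -> free_cons (inv_letter l) (free_cons l s) = s.
Proof.
case: s => [|l' s] /=; first by rewrite inv_letterK eqxx.
case: (l' =P _) => [-> | _] /= red_s; last by rewrite inv_letterK eqxx.
by case: s red_s => [//|l'' s] /= /andP[/negPf-> _].
Qed.

Lemma free_consVK l s :
  reduced s -> free_cons l (free_cons (inv_letter l) s) = s.
Proof. by move=> red_s; rewrite -{1}[l]inv_letterK free_consK. Qed.

Lemma reduced_cat s t : reduced t -> reduced (free_cat s t).
Proof. by move=> red_t; elim: s => //= l s; apply: reduced_cons. Qed.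

Lemma free_cat_cons l s t :
  reduced t -> free_cat (free_cons l s) t = free_cons l (free_cat s t).
Proof.
move=> red_t; case: s => //= l' s; case: eqP => //= ->.
by rewrite free_consVK // reduced_cat.
Qed.

Lemma free_catA s t u : reduced u ->
  free_cat s (free_cat t u) = free_cat (free_cat s t) u.
Proof. by move=> red_u; elim: s => //= l s ->; rewrite free_cat_cons. Qed.

Lemma free_cats0 s : reduced s -> free_cat s [::] = s.
Proof.
elim: s => //= l s IHs red_s; rewrite IHs; last exact: path_sorted red_s.
by case: s red_s {IHs} => //= l' s /andP[/negPf-> _].
Qed.

Lemma free_catVs s : free_cat (free_inv s) s = [::].
Proof.
rewrite /free_cat /free_inv; elim: s => //= l s IHs.
by rewrite rev_cons foldr_rcons /= inv_letterK eqxx.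
Qed.

Lemma free_invK : involutive free_inv.
Proof.
move=> s; rewrite /free_inv map_rev revK -map_comp.
by rewrite map_id_in // => l _; apply: inv_letterK.
Qed.

Lemma free_catsV s : free_cat s (free_inv s) = [::].
Proof. by rewrite -{1}[s]free_invK free_catVs. Qed.

Lemma reduced_inv s : reduced s -> reduced (free_inv s).
Proof.
rewrite /reduced /free_inv rev_sorted sorted_map; apply: sub_sorted => l l' /=.
by apply: contra => /eqP->; rewrite !inv_letterK.
Qed.

Record free_group := FreeGroup {
  free_word :> seq letter;
  free_wordP : reduced free_word
}.

HB.instance Definition _ := [isSub for free_word].
HB.instance Definition _ := [Choice of free_group by <:].

Definition free_one : free_group := @FreeGroup [::] isT.

Definition free_mul (u v : free_group) : free_group :=
  FreeGroup (reduced_cat u (free_wordP v)).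

Definition free_invg (u : free_group) : free_group :=
  FreeGroup (reduced_inv (free_wordP u)).

Lemma free_mulA : associative free_mul.
Proof. by move=> u v w; apply/val_inj/free_catA/free_wordP. Qed.

Lemma free_mul1 : left_id free_one free_mul.
Proof. by move=> u; apply/val_inj. Qed.

Lemma free_mulr1 : right_id free_one free_mul.
Proof. by move=> u; apply/val_inj/free_cats0/free_wordP. Qed.

Lemma free_mulV : left_inverse free_one free_invg free_mul.
Proof. by move=> u; apply/val_inj/free_catVs. Qed.

Lemma free_mulrV : right_inverse free_one free_invg free_mul.
Proof. by move=> u; apply/val_inj/free_catsV. Qed.

HB.instance Definition _ := isGroup.Build free_group
  free_mulA free_mul1 free_mulr1 free_mulV free_mulrV.

Definition free_gen (i : I) : free_group := @FreeGroup [:: (i, false)] isT.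

Definition letter_eval (H : groupType) (f : I -> H) (l : letter) : H :=
  if l.2 then (f l.1)^-1 else f l.1.

Definition free_eval (H : groupType) (f : I -> H) (w : free_group) : H :=
  \prod_(l <- w) letter_eval f l.

Lemma free_evalM (H : groupType) (f : I -> H) :
  {morph free_eval f : u v / u * v}.
Proof.
have evalV l : letter_eval f (inv_letter l) = (letter_eval f l)^-1.
  by case: l => i [] /=; rewrite /letter_eval /= ?invgK.
move=> u v; rewrite /free_eval /= -big_cat /=.
elim: (free_word u) => //= l s IHs; rewrite big_cons -IHs.
case: (free_cat s v) => [|l' t] /=; first by rewrite big_seq1 big_nil mulg1.
case: eqP => [-> | _]; last by rewrite !big_cons.
by rewrite big_cons evalV mulVKg.
Qed.

Lemma free_eval1 (H : groupType) (f : I -> H) : free_eval f 1 = 1.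
Proof. exact: big_nil. Qed.

HB.instance Definition _ (H : groupType) (f : I -> H) :=
  isUMagmaMorphism.Build free_group H (free_eval f)
    (conj (free_eval1 f) (free_evalM f)).

Lemma free_eval_gen (H : groupType) (f : I -> H) i :
  free_eval f (free_gen i) = f i.
Proof. exact: big_seq1. Qed.

End FreeGroup.

Notation free_group2 := (free_group bool).

Definition free_x : free_group2 := free_gen false.
Definition free_y : free_group2 := free_gen true.

Definition word_map (H : groupType) (w : free_group2) (a b : H) : H :=
  free_eval (fun i : bool => if i then b else a) w.

Definition word_image (gT : finGroupType) (w : free_group2) (G : {set gT}) :
    {set gT} :=
  [set word_map w a b | a in G, b in G].

Definition witnesses_chirality (gT : finGroupType) (w : free_group2)
    (G : {set gT}) : Prop :=
  exists2 g, g \in word_image w G & g^-1 \notin word_image w G.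

Definition cycle_perm (T : finType) (c : seq T) (Uc : uniq c) : {perm T} :=
  perm (can_inj (prev_next Uc)).

(* The usual generators (1,2,...,11) and (3,7,11,8)(4,10,5,6) of M_11, with the
   points 1, ..., 11 taken modulo 11, so that 11 is the point 0. *)
Definition M11_gen1 : {perm 'I_11} := perm (@GRing.addrI 'I_11 1%R).
Definition M11_gen2 : {perm 'I_11} :=
  @cycle_perm 'I_11 [:: 3; 7; 0; 8]%R isT *
  @cycle_perm 'I_11 [:: 4; 10; 5; 6]%R isT.

Definition M11 : {group {perm 'I_11}} := <<[set M11_gen1; M11_gen2]>>%G.

(* Main.v *)
(** Let M be M_11 acting on Z/11, with g : i |-> i + 1 its first generator.
    For a in M, the element u = a^-440 is 1 or has order 3, and the elements of
    order 3 form a single class, so up to conjugation a value of w is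
    c(u, v) = [u u^v u, v^(uv) v] with u a fixed element of order 3 and v one of
    441 elements.  If g^-1 were a value of w, then some c(u, v)^-1 would be g^m
    with m in M; replacing m by g^i m, one may take m to fix 0, so that m is
    the map i |-> (c(u, v)^-i)(0).  Thus it is enough to check, for each v, that
    this sequence is not in the point stabiliser M_10, which has 720 elements.
    Permutations are computed with as the lists of their values. *)

Require Import Defs.
From mathcomp Require Import all_boot all_algebra all_fingroup.
From mathcomp Require Import cyclic.

Set Implicit Arguments.
Unset Strict Implicit.
Unset Printing Implicit Defensive.

Local Open Scope group_scope.

(** * Permutations computed as lists of their values *)

Section PermSeq.

Variable n : nat.
Implicit Types s t : {perm 'I_n.+1}.

Definition perm_seq s : seq nat := mkseq (fun i => val (s (inord i))) n.+1.

Lemma size_perm_seq s : size (perm_seq s) = n.+1.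
Proof. exact: size_mkseq. Qed.

Lemma nth_perm_seq s (i : 'I_n.+1) : nth 0 (perm_seq s) i = s i.
Proof. by rewrite nth_mkseq // inord_val. Qed.

Lemma eq_from_perm_seq s (k : seq nat) :
  size k = n.+1 -> (forall i : 'I_n.+1, nth 0 k i = s i) -> perm_seq s = k.
Proof.
move=> szk eq_k; apply: (@eq_from_nth _ 0); rewrite size_perm_seq // => i lt_i.
by rewrite -[i]/(nat_of_ord (Ordinal lt_i)) nth_perm_seq eq_k.
Qed.

Lemma perm_seq_inj : injective perm_seq.
Proof.
move=> s t eq_st; apply/permP => i; apply: val_inj.
by rewrite /= -!nth_perm_seq eq_st.
Qed.

Lemma perm_seq_uniq s : uniq (perm_seq s).
Proof.
rewrite map_inj_in_uniq ?iota_uniq // => i j; rewrite !mem_iota /= => lti ltj.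
by move/val_inj/perm_inj/(congr1 val); rewrite /= !inordK.
Qed.

Definition comp_seq (k l : seq nat) := [seq nth 0 l i | i <- k].

Definition inv_seq (k : seq nat) := mkseq (index^~ k) (size k).

Definition conj_seq (k l : seq nat) :=
  comp_seq (inv_seq l) (comp_seq k l).

Definition comm_seq (k l : seq nat) := comp_seq (inv_seq k) (conj_seq k l).

Definition exp_seq (k : seq nat) m := iter m (comp_seq k) (iota 0 (size k)).

Lemma perm_seq1 : perm_seq 1 = iota 0 n.+1.
Proof.
by apply: eq_from_perm_seq; rewrite ?size_iota // => i; rewrite nth_iota ?perm1.
Qed.

Lemma perm_seqM s t : perm_seq (s * t) = comp_seq (perm_seq s) (perm_seq t).
Proof.
apply: eq_from_perm_seq => [|i]; first by rewrite size_map size_perm_seq.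
by rewrite (nth_map 0) ?size_perm_seq // !nth_perm_seq permM.
Qed.

Lemma perm_seqV s : perm_seq s^-1 = inv_seq (perm_seq s).
Proof.
apply: eq_from_perm_seq => [|i]; first by rewrite size_mkseq size_perm_seq.
rewrite nth_mkseq ?size_perm_seq // -{1}[i](permKV s) -nth_perm_seq.
by rewrite index_uniq ?size_perm_seq ?perm_seq_uniq.
Qed.

Lemma perm_seqJ s t : perm_seq (s ^ t) = conj_seq (perm_seq s) (perm_seq t).
Proof. by rewrite !perm_seqM perm_seqV. Qed.

Lemma perm_seqR s t : perm_seq [~ s, t] = comm_seq (perm_seq s) (perm_seq t).
Proof. by rewrite perm_seqM perm_seqV perm_seqJ. Qed.

Lemma perm_seqX s m : perm_seq (s ^+ m) = exp_seq (perm_seq s) m.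
Proof.
rewrite /exp_seq size_perm_seq; elim: m => [|m IHm]; first exact: perm_seq1.
by rewrite expgS perm_seqM IHm.
Qed.

End PermSeq.

(** * Bounded closure under a step function *)

Section Closure.

Variables (A : eqType) (step : A -> seq A).

(** Running out of fuel yields a partial list: [closure_seq_ind] gives soundness, and closedness of
    a result is left to computation. *)
Fixpoint closure_seq fuel (todo seen : seq A) :=
  if fuel is fuel'.+1 then
    if todo is x :: todo' then
      if x \in seen then closure_seq fuel' todo' seen
      else closure_seq fuel' (step x ++ todo') (x :: seen)
    else seen
  else seen.

Lemma closure_seq_ind (P : A -> Prop) fuel todo seen :
    (forall x, P x -> {in step x, forall y, P y}) ->
    {in todo, forall x, P x} -> {in seen, forall x, P x} ->
  {in closure_seq fuel todo seen, forall x, P x}.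
Proof.
move=> stepP; elim: fuel todo seen => [//|fuel IH] [//|x todo] seen Ptodo Pseen.
have Px : P x by apply: Ptodo; rewrite mem_head.
have {}Ptodo : {in todo, forall y, P y}.
  by move=> y ty; apply: Ptodo; rewrite inE ty orbT.
rewrite /=; case: ifP => _; apply: IH => // y; rewrite ?mem_cat ?inE.
  by case/orP => [/(stepP x Px)|/Ptodo].
by case/predU1P => [->|/Pseen].
Qed.

End Closure.

(** * The word with its powers factored out, and its evaluation *)

Definition core_word (gT : groupType) (u v : gT) : gT :=
  [~ u * u ^ v * u, v ^ (u * v) * v].

Definition core_seq (u v : seq nat) : seq nat :=
  comm_seq (comp_seq (comp_seq u (conj_seq u v)) u)
    (comp_seq (conj_seq v (comp_seq u v)) v).

(** Lets a simultaneous conjugation move the first argument to [x3]. *)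
Lemma core_wordJ (gT : groupType) (u v h : gT) :
  core_word u v ^ h = core_word (u ^ h) (v ^ h).
Proof.
rewrite /core_word conjRg 2!(conjMg _ _ h) (conjJg u v h).
by rewrite (conjMg _ v h) (conjJg v _ h) (conjMg u v h).
Qed.

Lemma word_map_core (H : groupType) (u v : free_group2) (a b : H) :
  word_map (core_word u v) a b = core_word (word_map u a b) (word_map v a b).
Proof.
by rewrite /word_map /core_word gmulfR 2!gmulfM gmulfJ gmulfM gmulfJ gmulfM.
Qed.

Lemma word_mapXVn (H : groupType) (u : free_group2) m (a b : H) :
  word_map (u ^- m) a b = word_map u a b ^- m.
Proof. exact: gmulfXVn. Qed.

Lemma word_map_x (H : groupType) (a b : H) : word_map free_x a b = a.
Proof. exact: free_eval_gen. Qed.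

Lemma word_map_y (H : groupType) (a b : H) : word_map free_y a b = b.
Proof. exact: free_eval_gen. Qed.

(** * Word images under isomorphisms *)

Section WordImageMorph.

Variables (aT rT : finGroupType) (D : {group aT}).
Implicit Types (w : free_group2) (a b : aT).

Lemma letter_eval_in a b l : a \in D -> b \in D ->
  letter_eval (fun i : bool => if i then b else a) l \in D.
Proof. by move=> Da Db; case: l => [[] []]; rewrite ?groupV. Qed.

Lemma word_map_in w a b : a \in D -> b \in D -> word_map w a b \in D.
Proof. by move=> Da Db; apply: group_prod => l _; apply: letter_eval_in. Qed.

Lemma word_map_morph (f : {morphism D >-> rT}) w a b :
  a \in D -> b \in D -> f (word_map w a b) = word_map w (f a) (f b).
Proof.
move=> Da Db; rewrite /word_map /free_eval morph_prod => [|l _].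
  by apply: eq_bigr => -[[] []] _; rewrite /letter_eval /= ?morphV.
exact: letter_eval_in.
Qed.

Lemma word_image_sub w : word_image w D \subset D.
Proof. by apply/subsetP=> _ /imset2P[a b Da Db ->]; apply: word_map_in. Qed.

Lemma mem_word_image_injm (f : {morphism D >-> rT}) w g : 'injm f -> g \in D ->
  (f g \in word_image w (f @* D)) = (g \in word_image w D).
Proof.
move=> injf Dg; apply/imset2P/imset2P => [|[a b Da Db ->]].
  case=> _ _ /morphimP[a _ Da ->] /morphimP[b _ Db ->].
  rewrite -word_map_morph // => /(injmP injf) eq_g.
  by exists a b => //; apply: eq_g; rewrite ?word_map_in.
by exists (f a) (f b); rewrite ?mem_morphim ?word_map_morph.
Qed.

(** An isomorphism carries word values to word values and reflects them, which reduces the theorem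
    to the concrete group [M11]. *)
Lemma word_image_isog (E : {group rT}) w n : D \isog E ->
    (exists g,
       [/\ g \in word_image w D, #[g] = n & g^-1 \notin word_image w D]) ->
  exists g, [/\ g \in word_image w E, #[g] = n & g^-1 \notin word_image w E].
Proof.
case/isogP=> f injf <- [g [wg og wgV]].
have Dg := subsetP (word_image_sub w) g wg.
exists (f g); rewrite -morphV // !mem_word_image_injm ?groupV //.
by rewrite order_injm.
Qed.

End WordImageMorph.

(** Used with [m = 440 = 8 * 5 * 11]: element orders in M_11 divide [3 * 440], so 440th powers have
    order 1 or 3. *)
Definition core_pow m (gT : groupType) (a b : gT) : gT :=
  core_word (a ^- m) (b ^- m).

Lemma perm_seq_core n (u v : {perm 'I_n.+1}) :
  perm_seq (core_word u v) = core_seq (perm_seq u) (perm_seq v).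
Proof. by rewrite perm_seqR /conjg !(perm_seqM, perm_seqV). Qed.

(** * The generators as lists, and an element of order 3 *)

Definition gen1_seq : seq nat := [:: 1; 2; 3; 4; 5; 6; 7; 8; 9; 10; 0]%N.
Definition gen2_seq : seq nat := [:: 8; 1; 2; 7; 10; 6; 4; 0; 3; 9; 5]%N.

Lemma perm_seq_gen1 : perm_seq M11_gen1 = gen1_seq.
Proof.
apply: eq_from_perm_seq => // -[i lti]; rewrite permE.
by do 11?[case: i lti => // i lti].
Qed.

Lemma perm_seq_gen2 : perm_seq M11_gen2 = gen2_seq.
Proof.
apply: eq_from_perm_seq => // -[i lti]; rewrite permM !permE.
by do 11?[case: i lti => // i lti].
Qed.

(** The generator [i |-> i + 1] acts before [s], so it shifts the indices of the list; [rot] beyond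
    the length does nothing, whence the bound. *)
Lemma gen1_seqX i (s : {perm 'I_11}) : i <= 11 ->
  perm_seq (M11_gen1 ^+ i * s) = rot i (perm_seq s).
Proof.
elim: i => [|i IHi] lt_i; first by rewrite mul1g rot0.
have rot1 t : perm_seq (M11_gen1 * t) = rot 1 (perm_seq t).
  rewrite perm_seqM perm_seq_gen1; move: (size_perm_seq t).
  by case: (perm_seq t) => // k0; do 10?[case=> // ?]; case.
by rewrite expgS -mulgA rot1 IHi 1?ltnW // -rotS ?size_perm_seq.
Qed.

Lemma order_gen1 : #[M11_gen1] = 11.
Proof.
apply: nt_prime_order => //.
  by apply: perm_seq_inj; rewrite -[_ ^+ _]mulg1 gen1_seqX // perm_seq1.
by apply/eqP => /(congr1 (@perm_seq _)); rewrite perm_seq_gen1 perm_seq1.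
Qed.

Lemma gen1_M11 : M11_gen1 \in M11.
Proof. by rewrite mem_gen // set21. Qed.

Lemma gen2_M11 : M11_gen2 \in M11.
Proof. by rewrite mem_gen // set22. Qed.

(** In cycles, [(0 1 2)(3 5 10)(6 8 9)]: the fixed element u of order 3. *)
Definition x3 : {perm 'I_11} := M11_gen1 * M11_gen2 ^+ 2.
Definition x3_seq := comp_seq gen1_seq (exp_seq gen2_seq 2).

Lemma x3_M11 : x3 \in M11.
Proof. by rewrite groupM ?groupX ?gen1_M11 ?gen2_M11. Qed.

Lemma perm_seq_x3 : perm_seq x3 = x3_seq.
Proof. by rewrite perm_seqM perm_seqX perm_seq_gen1 perm_seq_gen2. Qed.

(* By [gen1_seqX], rotating the list of [s] amounts to multiplying [s] on the
   left by a power of [M11_gen1]. *)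
Definition to_rot0 (k : seq nat) := rot (index 0 k) k.

(** * Reduction of chirality to finite checks *)

Section Certificate.

(* The lists are kept abstract here, and instantiated by [M10_seqs] and
   [class3_seqs] at the end, because unification would unfold them. *)
Variables stab0 class3 : seq (seq nat).

Hypothesis stab0_1 : iota 0 11 \in stab0.
Hypothesis stab0_0 : all (fun k => nth 0 k 0 == 0) stab0.
Hypothesis stab0_closed :
  all (fun k => all (fun l => to_rot0 (comp_seq k l) \in stab0)
                    [:: gen1_seq; gen2_seq]) stab0.
Hypothesis class3P : forall k, k \in class3 ->
  exists2 h, h \in M11 & k = perm_seq (x3 ^ h).
(** By [M11_rot] these rotations include every element of M. Taking the power in steps 8, 5, 11
    costs 24 products instead of 440. *)
Hypothesis exp440_seqs :
  all (fun k => all (fun i =>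
    exp_seq (exp_seq (exp_seq (rot i k) 8) 5) 11 \in iota 0 11 :: class3)
    (iota 0 11)) stab0.
Hypothesis core_seqs_not_conj :
  all (fun v => traject (nth 0 (inv_seq (core_seq x3_seq v))) 0 11
                  \notin stab0) (iota 0 11 :: class3).

(** A Schreier argument: along a product of generators, [stab0_closed] absorbs one generator at a
    time, each rotation being a further left factor in [<g>]. *)
Lemma M11_rot s : s \in M11 ->
  exists2 h, h \in <[M11_gen1]> & perm_seq (h * s) \in stab0.
Proof.
case/gen_prodgP => m [f genf ->]; elim: m f genf => [|m IHm] f genf.
  exists 1; first exact: group1.
  by rewrite big_ord0 mulg1 perm_seq1.
have [//|h Ch stab0_hs] := IHm (fun i => f (widen_ord (leqnSn m) i)).
rewrite big_ord_recr /=; set s' := \prod_(i < m) _ in stab0_hs *.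
set t := f _; set k := perm_seq (h * s') in stab0_hs.
have{stab0_hs}: to_rot0 (comp_seq k (perm_seq t)) \in stab0.
  have /= := allP (allP stab0_closed _ stab0_hs) (perm_seq t); apply.
  by rewrite /t; case/set2P: (genf ord_max) => ->;
    rewrite ?perm_seq_gen1 ?perm_seq_gen2 !inE eqxx ?orbT.
rewrite /to_rot0 -perm_seqM; set i := index _ _; rewrite -gen1_seqX; last first.
  by rewrite (leq_trans (index_size _ _)) ?size_perm_seq.
exists (M11_gen1 ^+ i * h); last by rewrite -mulgA [h * _]mulgA.
by rewrite groupM ?mem_cycle.
Qed.

Lemma exp440_M11 s : s \in M11 ->
  perm_seq (s ^+ 440) \in iota 0 11 :: class3.
Proof.
case/M11_rot=> h Ch stab0_hs.
(* With [h^-1 = g^i], the list of [s = h^-1 * (h * s)] is a rotation by [i] of a list in [stab0]. *)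
have [i lt_i def_hV] := cyclePmin (groupVr Ch).
have /allP/(_ i) := allP exp440_seqs _ stab0_hs.
rewrite order_gen1 in lt_i; rewrite mem_iota -gen1_seqX ?(ltnW lt_i) // -def_hV.
by rewrite mulKg -!perm_seqX -!expgM; apply.
Qed.

(** With [h] from [M11_rot], [h * m] fixes 0 and, [h] commuting with g, still conjugates g to [c].
    Hence it sends [i = g^i(0)] to [c^i(0)]. *)
Lemma gen1_conj_traject m c : m \in M11 -> M11_gen1 ^ m = c ->
  traject (nth 0 (perm_seq c)) 0 11 \in stab0.
Proof.
case/M11_rot=> h Ch stab0_hm def_c; set k := perm_seq (h * m) in stab0_hm.
suff -> : traject (nth 0 (perm_seq c)) 0 11 = k by [].
have {}def_c : M11_gen1 ^ (h * m) = c.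
  rewrite conjgM (_ : _ ^ h = M11_gen1) //; apply/conjg_fixP/commgP.
  exact: (centsP (cycle_abelian M11_gen1)) (cycle_id _) _ Ch.
have /eqP k0 := allP stab0_0 _ stab0_hm.
apply: (@eq_from_nth _ 0); rewrite size_traject ?size_perm_seq // => i lt_i.
rewrite (nth_traject _ lt_i); elim: i lt_i => // i IHi lt_i.
have nth_k j : j < 11 -> nth 0 k j = (h * m) (inord j) by exact: nth_mkseq.
rewrite iterS {}IHi ?(ltnW lt_i) // !nth_k ?(ltnW lt_i) // nth_perm_seq -def_c.
(* By [(h * m) * g ^ (h * m) = g * (h * m)], applying [c] to entry [i] gives entry [i + 1]. *)
rewrite -permM -conjgC permM; congr (val ((h * m) _)); apply: val_inj.
rewrite /= -nth_perm_seq perm_seq_gen1 !inordK ?(ltnW lt_i) //.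
by move: i lt_i; do 11?case=> //.
Qed.

Lemma gen1V_not_core a b : a \in M11 -> b \in M11 ->
  M11_gen1^-1 != core_pow 440 a b.
Proof.
(* The sign of the exponent is absorbed by replacing [a] and [b] with their inverses. *)
rewrite /core_pow -!expgVn => /groupVr Ma /groupVr Mb.
move: a^-1 b^-1 Ma Mb => {}a {}b Ma Mb; apply/eqP.
have := exp440_M11 Ma; rewrite inE -[iota 0 11]perm_seq1.
(* If [u = 1], the commutator is trivial, but g has order 11. *)
case/orP=> [/eqP/perm_seq_inj -> | ].
  rewrite /core_word conj1g !mulg1 comm1g => /(canRL (@invgK _)) g1.
  by have := order_gen1; rewrite g1 invg1 order1.
case/class3P => h Mh /perm_seq_inj ->.
(* Conjugation by [h^-1] turns the first argument into [x3], and [h^-1] is then the element m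
   conjugating g to an inverse core value. *)
have Mbh : b ^ h^-1 \in M11 by rewrite groupJ ?groupV.
have := allP core_seqs_not_conj _ (exp440_M11 Mbh).
rewrite -perm_seq_x3 -perm_seq_core -perm_seqV -conjXg => /negP not_conj def_g.
apply: not_conj; apply: (gen1_conj_traject (groupVr Mh)).
rewrite -[M11_gen1]invgK def_g conjVg; congr _^-1.
by rewrite core_wordJ conjgK.
Qed.

End Certificate.

(* The fuel is one more than twice the number of elements: each new element puts
   its two neighbours on the list of elements to visit. *)
Definition M10_seqs : seq (seq nat) :=
  closure_seq
    (fun k => [:: to_rot0 (comp_seq k gen1_seq); to_rot0 (comp_seq k gen2_seq)])
    1441 [:: iota 0 11] [::].

Definition class3_seqs : seq (seq nat) :=
  closure_seq (fun k => [:: conj_seq k gen1_seq; conj_seq k gen2_seq])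
    881 [:: x3_seq] [::].

Lemma class3_seqsP k : k \in class3_seqs ->
  exists2 h, h \in M11 & k = perm_seq (x3 ^ h).
Proof.
move: k; apply: closure_seq_ind => [k [h Mh ->] l|k|k]; last by [].
  rewrite !inE -perm_seq_gen1 -perm_seq_gen2 -!perm_seqJ -!conjgM.
  by case/orP => /eqP->; [exists (h * M11_gen1) | exists (h * M11_gen2)];
    rewrite // groupM ?gen1_M11 ?gen2_M11.
by rewrite inE => /eqP->; exists 1; rewrite ?group1 ?conjg1 ?perm_seq_x3.
Qed.

Lemma M10_seqs_closed :
  [&& iota 0 11 \in M10_seqs, all (fun k => nth 0 k 0 == 0) M10_seqs
    & all (fun k => all (fun l => to_rot0 (comp_seq k l) \in M10_seqs)
                      [:: gen1_seq; gen2_seq]) M10_seqs].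
Proof. by vm_compute. Qed.

Lemma M10_seqs_exp440 :
  all (fun k => all (fun i =>
    exp_seq (exp_seq (exp_seq (rot i k) 8) 5) 11 \in iota 0 11 :: class3_seqs)
    (iota 0 11)) M10_seqs.
Proof. by vm_compute. Qed.

Lemma class3_seqs_core :
  all (fun v => traject (nth 0 (inv_seq (core_seq x3_seq v))) 0 11
                  \notin M10_seqs) (iota 0 11 :: class3_seqs).
Proof. by vm_compute. Qed.

(** * A pair at which the word takes the value g, and the conclusion *)

Definition wit1_seq : seq nat := [:: 10; 0; 9; 3; 2; 8; 6; 5; 7; 4; 1]%N.
Definition wit2_seq : seq nat := [:: 4; 1; 6; 8; 5; 0; 9; 3; 7; 2; 10]%N.

Lemma core_seq_wit :
  [&& wit1_seq \in class3_seqs, wit2_seq \in class3_seqs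
    & core_seq wit1_seq wit2_seq == gen1_seq].
Proof. by vm_compute. Qed.

(** As [441 = 3 * 147], an element of order 3 satisfies [a ^+ 441 = 1], so it is its own power of
    exponent -440. *)
Lemma class3_exp k : k \in class3_seqs ->
  exists a, [/\ a \in M11, a ^- 440 = a & perm_seq a = k].
Proof.
case/class3_seqsP => h Mh ->; exists (x3 ^ h).
split; rewrite ?groupJ ?x3_M11 // -conjXg -conjVg; congr (_ ^ _).
have x3_3 : x3 ^+ 3 = 1.
  by apply: perm_seq_inj; rewrite perm_seqX perm_seq_x3 perm_seq1.
apply: (mulIg (x3 ^+ 440)); rewrite mulVg -expgS.
by rewrite (expgM x3 3 147) x3_3 expg1n.
Qed.

Lemma gen1_core : exists a b,
  [/\ a \in M11, b \in M11 & M11_gen1 = core_pow 440 a b].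
Proof.
have /and3P[] := core_seq_wit.
case/class3_exp=> a [Ma eq_a def_a].
case/class3_exp=> b [Mb eq_b def_b] /eqP core_ab.
exists a, b; split=> //; apply: perm_seq_inj.
by rewrite /core_pow eq_a eq_b perm_seq_core def_a def_b core_ab perm_seq_gen1.
Qed.

Theorem theorem2 (gT : finGroupType) (G : {group gT}) (isoG : G \isog M11) :
  let x := free_x in
  let y := free_y in
  let w : free_group2 :=
    [~ x ^- 440 * (x ^- 440) ^ (y ^- 440) * x ^- 440,
       (y ^- 440) ^ (x ^- 440 * y ^- 440) * y ^- 440] in
  (exists g : gT,
     [/\ g \in word_image w G, #[g] = 11 & g^-1 \notin word_image w G])
  /\ witnesses_chirality w G.
Proof.
move=> x y w.
have word_mapE (a b : {perm 'I_11}) : word_map w a b = core_pow 440 a b.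
  (* Here [core_word] is taken in the free group itself, then pushed through evaluation. *)
  rewrite -[w]/(core_word (x ^- 440) (y ^- 440)) word_map_core !word_mapXVn.
  by rewrite word_map_x word_map_y.
suff [g [imw_g og imw_gV]] : exists g : gT,
    [/\ g \in word_image w G, #[g] = 11 & g^-1 \notin word_image w G].
  by split; exists g.
apply: (word_image_isog (D := M11)); first by rewrite isog_sym.
exists M11_gen1; split; last 1 first.
- apply/imset2P => -[c d Mc Md]; rewrite word_mapE; apply/eqP.
  have /and3P[M10_1 M10_0 M10_closed] := M10_seqs_closed.
  exact: (gen1V_not_core M10_1 M10_0 M10_closed class3_seqsP
    M10_seqs_exp440 class3_seqs_core Mc Md).
- have [a [b [Ma Mb ->]]] := gen1_core.
  by apply/imset2P; exists a b.
exact: order_gen1.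
Qed.
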